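(* Let $T=2B$ acting on $X=\ell^2(\mathbb Z_+)$, where $B$ is the unweighted backward shift. There exist a uniformly distributed sequence of real numbers $(f(n))$ and a vector $x\in HC(T)$ such that $\{e^{2\pi i f(n)}T^n x;\ n\geq 1\}$ is not dense in $X$.
   Context: $\ell^2(\mathbb Z_+)$ is the complex Hilbert space of square-summable sequences indexed by $n\geq 0$, with standard basis $(e_n)_{n\geq 0}$; $B$ is the bounded operator with $Be_0=0$ and $Be_n=e_{n-1}$ for $n\geq 1$. $HC(T)$ is the set of hypercyclic vectors for $T$, i.e. vectors $x$ such that $\{T^n x;\ n\geq 0\}$ is dense in $X$. ''Uniformly distributed'' means uniformly distributed modulo 1: for every subarc $I$ of the unit circle $\mathbb T$, $\frac1n\mathrm{card}\{1\leq j\leq n;\ e^{2\pi i f(j)}\in I\}$ converges, as $n\to\infty$, to the normalized arc length of $I$. *)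

(* Defs.v *)
From HB Require Import structures.
From mathcomp Require Import all_boot all_order all_algebra.
From mathcomp Require Import all_classical all_reals all_analysis.
From mathcomp Require Import complex ring.
Set Implicit Arguments.
Unset Strict Implicit.
Unset Printing Implicit Defensive.
Import Order.TTheory GRing.Theory Num.Theory.
Import numFieldNormedType.Exports.
Local Open Scope classical_set_scope.
Local Open Scope complex_scope.
Local Open Scope ring_scope.

(* [Normc.normc] is the complex modulus with values in [R]; the canonical norm
   [`|z|] of [R[i]] is [(normc z)%:C]. *)
Definition square_summable (R : realType) : {pred nat -> R[i]} :=
  fun u => `[< cvgn (series (fun n => Normc.normc (u n) ^+ 2)) >].

Record ell2 (R : realType) := Ell2 {
  ell2_seq :> nat -> R[i];
  ell2_summable : ell2_seq \in @square_summable R }.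

Section ell2_lmodule.
Variable R : realType.
Implicit Types u v : nat -> R[i].

Lemma normc_ge0 (z : R[i]) : 0 <= Normc.normc z.
Proof. by case: z => a b; exact: sqrtr_ge0. Qed.

Lemma normcD_sqr (z w : R[i]) :
  Normc.normc (z + w) ^+ 2 <= 2 * (Normc.normc z ^+ 2 + Normc.normc w ^+ 2).
Proof.
case: z w => [a b] [c d] /=; rewrite !sqr_sqrtr ?addr_ge0 ?sqr_ge0 // -subr_ge0.
have -> : 2 * (a ^+ 2 + b ^+ 2 + (c ^+ 2 + d ^+ 2)) -
  ((a + c) ^+ 2 + (b + d) ^+ 2) = (a - c) ^+ 2 + (b - d) ^+ 2 :> R by ring.
by rewrite addr_ge0 ?sqr_ge0.
Qed.

Lemma square_summableP u :
  reflect (cvgn (series (fun n => Normc.normc (u n) ^+ 2)))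
          (u \in @square_summable R).
Proof. exact: asboolP. Qed.

Lemma square_summable_submod : submod_closed (@square_summable R).
Proof.
split.
  apply/square_summableP; rewrite (_ : (fun _ => _) = fun=> 0).
    by rewrite /series /=; under eq_fun do rewrite big1 //; exact: is_cvg_cst.
  by apply/funext => n; rewrite Normc.normc0 expr0n.
move=> a u v /square_summableP su /square_summableP sv.
apply/square_summableP.
pose U : R^nat := fun n => Normc.normc (u n) ^+ 2.
pose V : R^nat := fun n => Normc.normc (v n) ^+ 2.
have cUV : cvgn (series (2 *: (Normc.normc a ^+ 2 *: U + V))).
  exact: is_cvg_seriesZ (is_cvg_seriesD (is_cvg_seriesZ su) sv).
apply: series_le_cvg cUV => n; first exact: sqr_ge0.
  apply: mulr_ge0 => //; apply: addr_ge0; last exact: sqr_ge0.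
  by apply: mulr_ge0; exact: sqr_ge0.
rewrite !fctE /U /V /GRing.scale /= -exprMn -Normc.normcM.
exact: normcD_sqr.
Qed.

HB.instance Definition _ :=
  GRing.isSubmodClosed.Build R[i] (nat -> R[i]) (@square_summable R)
    square_summable_submod.

HB.instance Definition _ := [isSub for @ell2_seq R].
HB.instance Definition _ := gen_eqMixin (ell2 R).
HB.instance Definition _ := gen_choiceMixin (ell2 R).
HB.instance Definition _ := [SubChoice_isSubLmodule of ell2 R by <:].

Lemma ell2P (x y : ell2 R) : x =1 y -> x = y.
Proof. by move=> xy; apply/val_inj/funext. Qed.

Lemma ell2D (x y : ell2 R) n : (x + y) n = x n + y n. Proof. by []. Qed.

Lemma ell2Z (a : R[i]) (x : ell2 R) n : (a *: x) n = a * x n.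
Proof. by []. Qed.

End ell2_lmodule.

(* The limit exists by [ell2_summable]. *)
Definition ell2_norm (R : realType) (x : ell2 R) : R :=
  Num.sqrt (limn (series (fun n => Normc.normc (x n) ^+ 2))).

Section ell2_norm.
Variable R : realType.
Implicit Types x y : ell2 R.

Lemma ell2_cvg x : cvgn (series (fun n => Normc.normc (x n) ^+ 2)).
Proof. exact/square_summableP/ell2_summable. Qed.

Lemma partial_le_ell2_norm x n :
  series (fun n => Normc.normc (x n) ^+ 2) n <= ell2_norm x ^+ 2.
Proof.
have nd : nondecreasing_seq (series (fun n => Normc.normc (x n) ^+ 2)).
  by apply: nondecreasing_series => k _ _; exact: sqr_ge0.
have le k := nondecreasing_cvgn_le nd (@ell2_cvg x) k.
rewrite sqr_sqrtr //.
by apply: le_trans (le 0%N); rewrite /series /= big_geq.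
Qed.

Lemma ell2_norm_ge0 x : 0 <= ell2_norm x. Proof. exact: sqrtr_ge0. Qed.

Lemma ell2_norm_le x (c : R) : 0 <= c ->
  (forall n, series (fun n => Normc.normc (x n) ^+ 2) n <= c ^+ 2) ->
  ell2_norm x <= c.
Proof.
move=> c0 h; rewrite -[leRHS](ger0_norm c0) -sqrtr_sqr ler_wsqrtr //.
by apply: limr_le; [exact: ell2_cvg | apply: nearW].
Qed.

Lemma normc_le_ell2_norm x n : Normc.normc (x n) <= ell2_norm x.
Proof.
rewrite -(@ler_pXn2r _ 2) ?nnegrE ?normc_ge0 ?ell2_norm_ge0 //.
apply: le_trans (partial_le_ell2_norm x n.+1).
rewrite /series /= big_nat_recr //= lerDr.
by apply: sumr_ge0 => i _; exact: sqr_ge0.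
Qed.

Lemma sqrtr_minkowski (A B a b : R) : 0 <= A -> 0 <= B -> 0 <= a -> 0 <= b ->
  (A + B) ^+ 2 + (a + b) ^+ 2 <=
  (Num.sqrt (A ^+ 2 + a ^+ 2) + Num.sqrt (B ^+ 2 + b ^+ 2)) ^+ 2.
Proof.
move=> A0 B0 a0 b0.
rewrite [leRHS]sqrrD !sqr_sqrtr ?addr_ge0 ?sqr_ge0 //.
rewrite -sqrtrM ?addr_ge0 ?sqr_ge0 //.
have h : A * B + a * b <= Num.sqrt ((A ^+ 2 + a ^+ 2) * (B ^+ 2 + b ^+ 2)).
  rewrite -[leLHS]ger0_norm ?addr_ge0 ?mulr_ge0 // -sqrtr_sqr ler_wsqrtr //.
  rewrite -subr_ge0.
  have -> : (A ^+ 2 + a ^+ 2) * (B ^+ 2 + b ^+ 2) - (A * B + a * b) ^+ 2 =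
    (A * b - a * B) ^+ 2 by ring.
  exact: sqr_ge0.
rewrite -subr_ge0.
set S := Num.sqrt _ in h *.
have -> : A ^+ 2 + a ^+ 2 + S *+ 2 + (B ^+ 2 + b ^+ 2) -
  ((A + B) ^+ 2 + (a + b) ^+ 2) = 2 * (S - (A * B + a * b)) by ring.
by rewrite mulr_ge0 // subr_ge0.
Qed.

Lemma ell2_normD x y : ell2_norm (x + y) <= ell2_norm x + ell2_norm y.
Proof.
pose S (z : nat -> R[i]) n := \sum_(0 <= k < n) Normc.normc (z k) ^+ 2.
have S0 z n : 0 <= S z n by apply: sumr_ge0 => i _; exact: sqr_ge0.
have Sr z n : S z n.+1 = Num.sqrt (S z n) ^+ 2 + Normc.normc (z n) ^+ 2.
  by rewrite sqr_sqrtr // /S big_nat_recr.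
have tri n : S (x + y) n <= (Num.sqrt (S x n) + Num.sqrt (S y n)) ^+ 2.
  elim: n => [|n ih]; first by rewrite {1}/S big_geq // sqr_ge0.
  rewrite (Sr x) (Sr y).
  apply: le_trans (sqrtr_minkowski _ _ _ _); rewrite ?sqrtr_ge0 ?normc_ge0 //.
  rewrite {1}/S big_nat_recr //= lerD //.
  rewrite ler_pXn2r ?nnegrE ?addr_ge0 ?normc_ge0 //.
  exact: le_normcD.
apply: ell2_norm_le => [|n]; first by rewrite addr_ge0 ?ell2_norm_ge0.
apply: le_trans (tri n) _.
rewrite ler_pXn2r ?nnegrE ?addr_ge0 ?sqrtr_ge0 ?ell2_norm_ge0 //.
by apply: lerD; rewrite -[leRHS]ger0_norm ?ell2_norm_ge0 // -sqrtr_sqr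
  ler_wsqrtr // partial_le_ell2_norm.
Qed.

Lemma ell2_normZ (a : R[i]) x : ell2_norm (a *: x) = Normc.normc a * ell2_norm x.
Proof.
rewrite /ell2_norm.
have -> : series (fun n => Normc.normc ((a *: x) n) ^+ 2) =
   series (Normc.normc a ^+ 2 *: (fun n => Normc.normc (x n) ^+ 2)).
  by congr series; apply/funext => n; rewrite ell2Z Normc.normcM exprMn.
rewrite lim_seriesZ; last exact: ell2_cvg.
by rewrite sqrtrM ?sqr_ge0 // sqrtr_sqr ger0_norm ?normc_ge0.
Qed.

Lemma ell2_norm_eq0 x : ell2_norm x = 0 -> x = 0.
Proof.
move=> x0; apply: ell2P => n; apply: Normc.eq0_normc.
apply/eqP; rewrite eq_le normc_ge0 andbT -x0; exact: normc_le_ell2_norm.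
Qed.

Let ell2_normC x : R[i] := (ell2_norm x)%:C.

Let ell2_normCD x y : ell2_normC (x + y) <= ell2_normC x + ell2_normC y.
Proof. by rewrite -rmorphD /= lecR ell2_normD. Qed.

Let ell2_normCZ (a : R[i]) x : ell2_normC (a *: x) = `|a| * ell2_normC x.
Proof. by rewrite /ell2_normC ell2_normZ rmorphM; case: a. Qed.

Let ell2_normC_eq0 x : ell2_normC x = 0 -> x = 0.
Proof. by move=> /complexI; exact: ell2_norm_eq0. Qed.

HB.instance Definition _ :=
  Lmodule_isNormed.Build R[i] (ell2 R) ell2_normCD ell2_normCZ ell2_normC_eq0.

Lemma ell2_normE x : `|x| = (ell2_norm x)%:C. Proof. by []. Qed.

End ell2_norm.

Section backward_shift.
Variable R : realType.

Lemma ell2_basis_summable (n : nat) :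
  (fun k => (k == n)%:R) \in @square_summable R.
Proof.
apply/square_summableP; rewrite -(is_cvg_series_restrict n.+1).
rewrite (_ : (fun _ => _) = fun=> 0); first exact: is_cvg_cst.
apply/funext => m; rewrite big_nat_cond big1 // => k /andP[/andP[nk _] _].
by rewrite gtn_eqF // Normc.normc0 expr0n.
Qed.

Definition ell2_basis (n : nat) : ell2 R := Ell2 (ell2_basis_summable n).

Lemma backward_shift_summable (x : ell2 R) :
  (fun n => x n.+1) \in @square_summable R.
Proof.
apply/square_summableP.
have := @ell2_cvg _ x; rewrite -(is_cvg_series_restrict 1).
move=> /cvg_ex[l]; rewrite -cvg_shiftS => ul; apply/cvg_ex; exists l.
rewrite (_ : series _ =
  [sequence \sum_(1 <= k < n.+1) Normc.normc (x k) ^+ 2]_n) //.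
by apply/funext => n; rewrite /series /= big_add1.
Qed.

Definition backward_shift (x : ell2 R) : ell2 R :=
  Ell2 (backward_shift_summable x).

Lemma backward_shift_linear : linear backward_shift.
Proof. by move=> a x y; exact: ell2P. Qed.

HB.instance Definition _ :=
  GRing.isLinear.Build R[i] (ell2 R) (ell2 R) *:%R backward_shift
    backward_shift_linear.

Lemma backward_shift_basis0 : backward_shift (ell2_basis 0) = 0.
Proof. by apply: ell2P => k. Qed.

Lemma backward_shift_basisS n :
  backward_shift (ell2_basis n.+1) = ell2_basis n.
Proof. by apply: ell2P => k. Qed.

Lemma backward_shift_norm_le (x : ell2 R) : `|backward_shift x| <= `|x|.
Proof.
rewrite !ell2_normE lecR; apply: ell2_norm_le => [|n].
  exact: ell2_norm_ge0.
apply: le_trans (partial_le_ell2_norm x n.+1).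
by rewrite /series /= big_nat_recl // lerDr sqr_ge0.
Qed.

End backward_shift.

Definition hypercyclic_vectors (X : topologicalType) (T : X -> X) : set X :=
  [set x | dense [set iter n T x | n in [set: nat]]].

Definition expi (R : realType) (t : R) : R[i] := cos t +i* sin t.

Definition circle_arc (R : realType) (J : interval R) : set R[i] :=
  [set expi (2 * pi * t) | t in [set` J]].

(* Every subarc of the circle is [circle_arc J] for an interval [J] of length
   at most 1, whose length is the normalized length of the arc. [BSide true a] is
   the left of [a], so [a \in J] needs [ba] true and [b \in J] needs [bb] false. *)
Definition uniformly_distributed (R : realType) (f : nat -> R) : Prop :=
  forall (ba bb : bool) (a b : R), a <= b <= a + 1 ->
    let I := circle_arc (Interval (BSide ba a) (BSide bb b)) in
    (fun n : nat =>
       (count (fun j => `[< I (expi (2 * pi * f j)) >]) (iota 1 n))%:R / n%:R)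
      @ \oo --> b - a.

(* Main.v *)
Require Import Defs.
From mathcomp Require Import all_boot all_order all_algebra.
From mathcomp Require Import all_classical all_reals all_analysis.
From mathcomp Require Import complex.
From mathcomp Require Import ring lra zify.
Set Implicit Arguments.
Unset Strict Implicit.
Unset Printing Implicit Defensive.
Import Order.TTheory GRing.Theory Num.Theory.
Import numFieldNormedType.Exports.
Local Open Scope classical_set_scope.
Local Open Scope ring_scope.

(** Sparse hypercyclic vectors make the result easy.  Put [T = 2B] and write [x]
in the form [x n = w n / 2 ^ n]; then the coordinate of index 0 of [T^n x] is
[w n].  Suppose that [x] is hypercyclic but that [w] vanishes off a set [D] of
density zero.  Take any uniformly distributed sequence and change it on [D] only,
so that [e^(2 pi i f n) * w n] has nonpositive real part for every [n]: on [D]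
one of the phases 0 and 1/2 does it, and off [D] the number is 0 whatever [f n]
is.  Changing [f] on a set of density zero does not affect uniform distribution,
and no vector [e^(2 pi i f n) T^n x] lies in the unit ball around [e_0], since a
vector of that ball has a first coordinate with positive real part.

Both objects are built on the blocks [m^3 <= n < (m+1)^3].  The first [m] places
of block [m] make up the exceptional set [D].  There [x] carries the pattern
[d m / 2 ^ (m^3)], where [d] takes values dense in [ell2] with [d m] supported on
[0..m-1] ([small_patterns_dense]).  Then [T^(m^3) x] is [d m] plus a
remainder that only sees the blocks after [m], at distance of order [m^2].
The bound [|d m j| 2^j <= 2^m] turns into [|x n| 2^n <= 2^(cbrt n)], which makes
[x] summable and the remainder small ([scattered_hypercyclic]).

On the rest of block [m], of length [l], the sequence [f] runs through the
multiples [j / l].  Uniform distribution is read off floor functions: for an arc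
from [a] to [b] of length at most 1, [floor (t - a) - floor (t - b)] is
the indicator function of the arc, up to end points.  So it is enough that the
means of [floor (f n + x)] converge to [x]
([floor_mean_uniformly_distributed]).  A full block of equidistant points
contributes to the sum of [floor (f n + x) - x] an error at most 1
([floor_block_sum]), the exceptional places of block [m] at most [m], and an
incomplete last block at most its length [O(m^2)].  For [m = cbrt n] the sum up
to [n] is therefore [O(m^2)], negligible against [n >= m^3]. *)

(** * Characters of the circle *)

Lemma expiD (R : realType) (s t : R) : expi (s + t) = expi s * expi t.
Proof. by rewrite /expi cosD sinD; congr Complex; ring. Qed.

Lemma expi_nat (R : realType) (n : nat) : expi (2 * pi * n%:R) = 1 :> R[i].
Proof.
elim: n => [|n ih]; first by rewrite mulr0 /expi cos0 sin0.
rewrite -[n.+1]addn1 (natrD R n 1) mulrDr mulr1 expiD ih mul1r /expi.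
by rewrite mulr_natl cos2pi sin2pi.
Qed.

Lemma expi_int (R : realType) (k : int) : expi (2 * pi * k%:~R) = 1 :> R[i].
Proof.
case: k => n; first exact: expi_nat.
rewrite NegzE mulrNz mulrN.
have := @expiD R (2 * pi * n.+1%:R) (- (2 * pi * n.+1%:R)).
by rewrite subrr expi_nat mul1r => <-; rewrite /expi cos0 sin0.
Qed.

(** Up to the integer part, the difference of the two arguments is [d] in
[[0, 1)] with [cos (2 pi d) = 1], that is [sin (pi d) = 0]; the sine is positive
inside [(0, pi)]. *)
Lemma expi_eq (R : realType) (s t : R) :
  expi (2 * pi * s) = expi (2 * pi * t) -> exists k : int, s = t + k%:~R.
Proof.
move=> [ec es]; exists (Num.floor (s - t)).
set d := s - t - (Num.floor (s - t))%:~R.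
have [d0 d1] : 0 <= d /\ d < 1.
  have := floor_itv (s - t); rewrite intrD => /andP[h1 h2].
  by split; rewrite /d; lra.
have cd : cos (2 * pi * d) = 1.
  have : expi (2 * pi * d) = expi (2 * pi * (s - t)).
    rewrite -[RHS]mulr1 -(expi_int R (- Num.floor (s - t))) -expiD.
    by congr expi; rewrite /d mulrNz; ring.
  case=> -> _; rewrite mulrBr cosB ec es -!expr2; exact: cos2Dsin2.
suff d00 : d = 0 by move: d00; rewrite /d; lra.
apply/eqP; rewrite eq_le d0 andbT leNgt; apply/negP => dgt.
have : 0 < sin (pi * d).
  by apply: sin_gt0_pi; have := @pi_gt0 R => p0; rewrite mulr_gt0 //= gtr_pMr.
have : sin (pi * d) ^+ 2 = 0.
  rewrite sin2cos2.
  move: cd; rewrite (_ : 2 * pi * d = pi * d *+ 2); last by ring.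
  by rewrite cos_mulr2n mulr2n; lra.
by move/eqP; rewrite sqrf_eq0 => /eqP ->; rewrite ltxx.
Qed.

(** * Equidistribution through floor functions *)

(** The sum [G y] of [floor (j / l + y)] over [j < l] increases by exactly 1
when [y] does by [1 / l], because the terms are shifted by one place; hence
[G (k / l) = k] for every integer [k], and monotonicity bounds [G x] between the
two integers next to [l * x]. *)
Lemma floor_block_sum (R : realType) (l : nat) (x : R) : (0 < l)%N ->
  `|\sum_(0 <= j < l) ((Num.floor (j%:R / l%:R + x))%:~R - x)| <= 1.
Proof.
move=> l0; have lr : (0 : R) < l%:R by rewrite ltr0n.
pose G (y : R) := \sum_(0 <= j < l) Num.floor (j%:R / l%:R + y).
have Gmono (y z : R) : y <= z -> G y <= G z.
  by move=> yz; apply: ler_sum => j _; apply: le_floor; rewrite lerD2l.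
have Gstep (y : R) : G (y + l%:R^-1) = G y + 1.
  pose F (j : nat) := Num.floor (j%:R / l%:R + y).
  have -> : G (y + l%:R^-1) = \sum_(0 <= j < l) F j.+1.
    apply: eq_bigr => j _; congr Num.floor.
    by rewrite -[j.+1]addn1 natrD; field; rewrite gt_eqF.
  have : \sum_(0 <= j < l.+1) F j = G y + F l by rewrite big_nat_recr.
  rewrite big_nat_recl // {1 3}/F mul0r add0r divff ?gt_eqF //.
  rewrite floorDzr ?rpred1 // floor1 => h.
  by apply: (addrI (Num.floor y)); rewrite h; ring.
have Gnat (k : nat) (y : R) : G (y + k%:R / l%:R) = G y + k%:Z.
  elim: k => [|k ih]; first by rewrite mul0r !addr0.
  by rewrite -natr1 mulrDl mul1r addrA Gstep ih -addn1 PoszD addrA.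
have G0 : G 0 = 0.
  rewrite /G big_nat big1 // => j /andP[_ jl]; apply: floor_def.
  rewrite addr0 divr_ge0 //= add0r ltr_pdivrMr // mul1r ltr_nat //.
have Gint (k : int) : G (k%:~R / l%:R) = k.
  case: k => k; first by rewrite -[_ / _]add0r Gnat G0 add0r.
  have := Gnat k.+1 ((Negz k)%:~R / l%:R).
  rewrite -mulrDl NegzE mulrNz addNr mul0r G0 => h.
  by apply/eqP; rewrite -addr_eq0 -h.
have /andP[q1 q2] := floor_itv (l%:R * x); set q := Num.floor (l%:R * x) in q1 q2.
have h1 : q <= G x.
  by rewrite -(Gint q); apply: Gmono; rewrite ler_pdivrMr // mulrC.
have h2 : G x <= q + 1.
  by rewrite -(Gint (q + 1)); apply: Gmono; rewrite ler_pdivlMr // mulrC ltW.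
rewrite sumrB sumr_const_nat subn0 -[x *+ l]mulr_natl -rmorph_sum /= -/(G x).
move: q1 q2 h1 h2; rewrite -(ler_int R) -(ler_int R (G x)) intrD.
by rewrite ler_norml => *; apply/andP; split; lra.
Qed.

(** The difference of floors counts the integers [k] for which [t - k] lies
between [a - e] and [b + e], and a point of the arc provides one. The margin [e]
makes the kind of the end points irrelevant. *)
Lemma arc_indicator_ub (R : realType) (ba bb : bool) (a b e t : R) :
  a <= b -> 0 < e ->
  `[< circle_arc (Interval (BSide ba a) (BSide bb b)) (expi (2 * pi * t)) >]%:R
    <= (Num.floor (t + (e - a)))%:~R - (Num.floor (t - (b + e)))%:~R :> R.
Proof.
move=> ab e0; case: asboolP => [[u uJ /expi_eq[k uE]]|_] /=; last first.
  by rewrite subr_ge0 ler_int; apply: le_floor; lra.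
have [ua ub] : a <= u /\ u <= b.
  move: uJ; rewrite /= in_itv /=.
  by case: ba; case: bb => /= /andP[h1 h2]; split; lra.
have h1 : - k <= Num.floor (t + (e - a)).
  by rewrite floor_ge_int mulrNz; lra.
have h2 : Num.floor (t - (b + e)) < - k.
  by rewrite floor_lt_int mulrNz; lra.
by rewrite -intrB (ler_int R 1); lia.
Qed.

(** With the interval shrunk by [e] on each side, of length less than 1, the
difference of floors is at most 1, and it is 1 only when an integer translate of
[t] lies strictly between [a] and [b]. *)
Lemma arc_indicator_lb (R : realType) (ba bb : bool) (a b e t : R) :
  b <= a + 1 -> 0 < e ->
  (Num.floor (t - (a + e)))%:~R - (Num.floor (t + (e - b)))%:~R <=
  `[< circle_arc (Interval (BSide ba a) (BSide bb b)) (expi (2 * pi * t)) >]%:R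
    :> R.
Proof.
move=> ab e0.
have /andP[p1 p2] := floor_itv (t - (a + e)); set p := Num.floor _ in p1 p2 *.
have /andP[q1 q2] := floor_itv (t + (e - b)); set q := Num.floor _ in q1 q2 *.
have pq : p - q <= 1.
  by rewrite -ltzD1 -(ltr_int R) intrB; move: p1 q2; rewrite !intrD; lra.
case: asboolP => [_|nI] /=; first by rewrite -intrB (ler_int R _ 1).
rewrite -intrB (ler_int R _ 0) -ltzD1 ltNge; apply/negP => pq1; apply: nI.
exists (t - p%:~R).
  have : (q + 1)%:~R <= p%:~R :> R by rewrite ler_int; lia.
  by rewrite /= in_itv /=; case: ba; case: bb => ? /=; apply/andP; split; lra.
by rewrite mulrBr -mulrN -mulrNz expiD expi_int mulr1.
Qed.

(** The floor means at [- a -+ e] and [- b +- e] squeeze the arc frequency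
between [b - a - 2 e] and [b - a + 2 e] in the limit. *)
Lemma floor_mean_uniformly_distributed (R : realType) (f : nat -> R) :
  (forall x, (\sum_(1 <= n < N.+1) (Num.floor (f n + x))%:~R) / N%:R
     @[N --> \oo] --> x) ->
  uniformly_distributed f.
Proof.
move=> fx ba bb a b /andP[ab ba1] I.
have countE n : (count (fun j => `[< I (expi (2 * pi * f j)) >]) (iota 1 n))%:R
    = \sum_(1 <= j < n.+1) (`[< I (expi (2 * pi * f j)) >])%:R :> R.
  rewrite /index_iota subSS subn0 -sum1_count natr_sum big_mkcond /=.
  by apply: eq_bigr => j _; case: ifP.
apply/cvgrPdist_le => e e0; have e4 : 0 < e / 4 by rewrite divr_gt0.
have u1 := fx (e / 4 - a); have u2 := fx (- (b + e / 4)).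
have l1 := fx (- (a + e / 4)); have l2 := fx (e / 4 - b).
have /(_ _)/cvgrPdist_le/(_ _ e4) u := cvgB u1 u2.
have /(_ _)/cvgrPdist_le/(_ _ e4) l := cvgB l1 l2.
apply: filterS2 l u => N.
rewrite countE !fctE /= -!mulrBl -!sumrB.
set L := (\sum_(_ <= _ < _) (_ - _)); set U := (\sum_(_ <= _ < _) (_ - _)).
set S := \sum_(_ <= _ < _) _.
have LS : L / N%:R <= S / N%:R.
  by rewrite ler_wpM2r ?invr_ge0 //; apply: ler_sum => j _; exact: arc_indicator_lb.
have SU : S / N%:R <= U / N%:R.
  by rewrite ler_wpM2r ?invr_ge0 //; apply: ler_sum => j _; exact: arc_indicator_ub.
by rewrite !ler_norml => /andP[? ?] /andP[? ?]; apply/andP; split; lra.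
Qed.

(** * Sequences equidistant on cubic blocks *)

Lemma cbrtP (n : nat) : {m : nat | (m ^ 3 <= n < m.+1 ^ 3)%N}.
Proof.
elim: n => [|n [m /andP[h1 h2]]]; first by exists 0%N.
have [h3|h3] := leqP (m.+1 ^ 3) n.+1; last by exists m; rewrite (leqW h1) h3.
exists m.+1; rewrite h3 /=; apply: leq_ltn_trans h2 _.
by rewrite ltn_exp2r.
Qed.

Definition cbrt (n : nat) : nat := sval (cbrtP n).

Lemma cbrt_bounds n : (cbrt n ^ 3 <= n < (cbrt n).+1 ^ 3)%N.
Proof. exact: svalP (cbrtP n). Qed.

Lemma cbrt_ge m n : (m ^ 3 <= n)%N -> (m <= cbrt n)%N.
Proof.
move=> mn; have /andP[_ h] := cbrt_bounds n.
by rewrite -ltnS -(@ltn_exp2r _ _ 3) //; exact: leq_ltn_trans mn h.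
Qed.

Lemma cbrt_eq m n : (m ^ 3 <= n < m.+1 ^ 3)%N -> cbrt n = m.
Proof.
move=> /andP[h1 h2]; apply/eqP; rewrite eqn_leq cbrt_ge // andbT.
rewrite -ltnS -(@ltn_exp2r _ _ 3) //; apply: leq_ltn_trans h2.
by have /andP[] := cbrt_bounds n.
Qed.

Lemma floor_error_le1 (R : realType) (t x : R) : 0 <= t < 1 ->
  `|(Num.floor (t + x))%:~R - x| <= 1.
Proof.
move=> /andP[t0 t1]; have /andP[] := floor_itv (t + x).
by rewrite intrD ler_norml => h1 h2; apply/andP; split; lra.
Qed.

Lemma floor_dist_le1 (R : realType) (s t x : R) : 0 <= s < 1 -> 0 <= t < 1 ->
  `|(Num.floor (s + x))%:~R - (Num.floor (t + x))%:~R| <= 1 :> R.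
Proof.
move=> /andP[s0 s1] /andP[t0 t1].
rewrite -intrB -intr_norm (ler_int R _ 1).
have /andP[a1 a2] := floor_itv (s + x); have /andP[b1 b2] := floor_itv (t + x).
have : (Num.floor (s + x) < Num.floor (t + x) + 2)%R.
  by rewrite -(ltr_int R) intrD; move: a2 b2; rewrite !intrD; lra.
have : (Num.floor (t + x) < Num.floor (s + x) + 2)%R.
  by rewrite -(ltr_int R) intrD; move: a2 b2; rewrite !intrD; lra.
lia.
Qed.

(** The block has length about [3 m ^ 2]; its first [m] terms are left free to
carry prescribed phases, which are too few to disturb the distribution. *)
Definition cubic_block_sequence (R : realType) (f : nat -> R) : Prop :=
  forall m j, (m ^ 3 + j < m.+1 ^ 3)%N ->
    0 <= f (m ^ 3 + j)%N < 1 /\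
    ((m <= j)%N -> f (m ^ 3 + j)%N = j%:R / (m.+1 ^ 3 - m ^ 3)%:R).

(** Compared with a full block of equidistant points, only the first [m]
terms change, each by at most 1. *)
Lemma cubic_block_error (R : realType) (f : nat -> R) (x : R) (m : nat) :
  cubic_block_sequence f ->
  `|\sum_(m ^ 3 <= n < m.+1 ^ 3) ((Num.floor (f n + x))%:~R - x)| <= m.+1%:R.
Proof.
move=> fm; set l := (m.+1 ^ 3 - m ^ 3)%N.
have l0 : (0 < l)%N by rewrite subn_gt0 ltn_exp2r.
have lr : (0 : R) < l%:R by rewrite ltr0n.
rewrite -[X in \sum_(X <= _ < _) _]add0n big_addn -/l.
(* [g] is the error of the unmodified equidistant block. *)
pose g (j : nat) : R := (Num.floor (j%:R / l%:R + x))%:~R - x.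
rewrite (eq_bigr (fun j => g j +
  ((Num.floor (f (j + m ^ 3)%N + x))%:~R - (Num.floor (j%:R / l%:R + x))%:~R)));
  last by move=> j _; rewrite /g; ring.
rewrite big_split /= -[m.+1%:R]natr1 addrC.
apply: le_trans (ler_normD _ _) _; apply: lerD; last exact: floor_block_sum.
apply: le_trans (ler_norm_sum _ _ _) _.
apply: (@le_trans _ _ (\sum_(0 <= j < l) (j < m)%N%:R)).
  rewrite big_nat [leRHS]big_nat; apply: ler_sum => j /andP[_ jl].
  have [f01 fE] := fm m j ltac:(by rewrite -ltn_subRL).
  rewrite addnC; have [mj|jm] := leqP m j; first by rewrite fE // subrr normr0.
  apply: floor_dist_le1 => //.
  by rewrite divr_ge0 //= ltr_pdivrMr // mul1r ltr_nat.
rewrite -natr_sum ler_nat -big_mkcond /= sum1_count.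
rewrite (@eq_count _ _ (mem (iota 0 m))); last by move=> j; rewrite /= mem_iota.
rewrite /index_iota subn0.
apply: leq_trans (_ : size (iota 0 m) <= m)%N; last by rewrite size_iota.
rewrite -size_filter; apply: uniq_leq_size; first by rewrite filter_uniq ?iota_uniq.
by move=> j; rewrite mem_filter => /andP[].
Qed.

(** The errors of the blocks up to [m] add up to at most [(m + 1) ^ 2], and
the incomplete block adds its length at most. The total, at most [8 (cbrt N) ^ 2],
is negligible against [N >= (cbrt N) ^ 3]. *)
Lemma cubic_block_sequence_uniformly_distributed (R : realType) (f : nat -> R) :
  cubic_block_sequence f -> uniformly_distributed f.
Proof.
move=> fm; apply: floor_mean_uniformly_distributed => x.
pose e n : R := (Num.floor (f n + x))%:~R - x.
have e1 n : `|e n| <= 1.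
  have /andP[h1 h2] := cbrt_bounds n; rewrite /e -(subnKC h1).
  by apply: floor_error_le1; apply: (fm _ _ _).1; rewrite subnKC.
have full m : `|\sum_(1 <= n < m.+1 ^ 3) e n| <= m.+1%:R ^+ 2.
  elim: m => [|m ih]; first by rewrite big_geq // normr0 sqr_ge0.
  rewrite (@big_cat_nat _ _ _ (m.+1 ^ 3)) ?expn_gt0 ?leq_exp2r //=.
  apply: le_trans (ler_normD _ _) _.
  apply: le_trans (lerD ih (cubic_block_error x m.+1 fm)) _.
  by rewrite -!natrX -natrD ler_nat; nia.
have bound N : (0 < N)%N -> `|\sum_(1 <= n < N.+1) e n| * (cbrt N)%:R <= 8 * N%:R.
  move=> N0; have /andP[] := cbrt_bounds N.
  have : (0 < cbrt N)%N by apply: cbrt_ge.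
  case: (cbrt N) => // m _ h1 h2.
  have h : `|\sum_(1 <= n < N.+1) e n| <= (8 * m.+1 ^ 2)%N%:R.
    rewrite (@big_cat_nat _ _ _ (m.+1 ^ 3)) ?expn_gt0 ?(leqW h1) //=.
    apply: le_trans (ler_normD _ _) _; apply: le_trans (lerD (full m) _) _.
      apply: le_trans (ler_norm_sum _ _ _) (ler_sum _ (fun i _ => e1 i)).
    rewrite sumr_const_nat -natrX -natrD ler_nat.
    by move: h1 h2; rewrite !expnS expn0; nia.
  apply: (@le_trans _ _ ((8 * m.+1 ^ 2)%N%:R * m.+1%:R)).
    by rewrite ler_wpM2r.
  by rewrite -!natrM ler_nat; move: h1; rewrite !expnS expn0; nia.
apply/cvgrPdist_le => d d0.
have [K K8] : exists K : nat, 8 / d < K%:R.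
  by exists (Num.trunc (8 / d)).+1; rewrite truncnS_gt.
near=> N.
have N0 : (0 < N)%N by near: N; exists 1%N.
have NK : (K ^ 3 <= N)%N by near: N; exists (K ^ 3)%N.
have Kp : (0 : R) < (cbrt N)%:R by rewrite ltr0n; apply: cbrt_ge.
have -> : x - (\sum_(1 <= n < N.+1) (Num.floor (f n + x))%:~R) / N%:R =
    - ((\sum_(1 <= n < N.+1) e n) / N%:R).
  rewrite sumrB sumr_const_nat subn1 /= -[x *+ N]mulr_natl.
  by field; rewrite pnatr_eq0 -lt0n.
rewrite normrN normrM normfV normr_nat ler_pdivrMr ?ltr0n //.
rewrite -(ler_pM2r Kp); apply: le_trans (bound _ N0) _.
rewrite mulrAC ler_pM2r ?ltr0n // -ler_pdivrMl // mulrC.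
by apply: le_trans (ltW K8) _; rewrite ler_nat cbrt_ge.
Unshelve. all: by end_near.
Qed.

(** * Density of finitely supported patterns *)

Lemma finite_support_summable (R : realType) (u : nat -> R[i]) (L : nat) :
  (forall j, (L <= j)%N -> u j = 0) -> u \in @square_summable R.
Proof.
move=> u0; apply/square_summableP; rewrite -(is_cvg_series_restrict L).
rewrite (_ : (fun _ => _) = fun=> 0); first exact: is_cvg_cst.
apply/funext => n; rewrite big_nat_cond big1 // => k /andP[/andP[Lk _] _].
by rewrite u0 // Normc.normc0 expr0n.
Qed.

Lemma ell2B (R : realType) (x y : ell2 R) n : (x - y) n = x n - y n.
Proof. by []. Qed.

Definition rational_seq (R : realType) (s : seq (rat * rat)) (j : nat) : R[i] :=
  let q := nth (0, 0) s j in (ratr q.1 +i* ratr q.2)%C.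

Lemma rational_seq_default (R : realType) s j :
  (size s <= j)%N -> rational_seq R s j = 0.
Proof. by move=> sj; rewrite /rational_seq nth_default // !rmorph0. Qed.

Definition rational_vector (R : realType) (s : seq (rat * rat)) : ell2 R :=
  Ell2 (finite_support_summable (@rational_seq_default R s)).

(** Half of the squared error is spent on the tail of [y] beyond some [L], the
other half on rational approximation of the first [L] coordinates, each with
squared error at most [e ^ 2 / (8 (L + 1))]. *)
Lemma rational_vector_dense (R : realType) (y : ell2 R) (e : R) : 0 < e ->
  exists s, ell2_norm (y - rational_vector R s) < e.
Proof.
move=> e0; pose h := e ^+ 2 / 8.
have h0 : 0 < h by rewrite divr_gt0 ?exprn_gt0.
pose S n := \sum_(0 <= k < n) Normc.normc (y k) ^+ 2.
have [L SL] : exists L, forall n, S n <= S L + h.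
  have /cvgrPdist_le/(_ _ h0)[L _ /(_ L (leqnn L)) LP] := @ell2_cvg _ y.
  exists L => n; move: LP; rewrite ler_norml => /andP[_].
  rewrite lerBlDl; apply: le_trans.
  apply: nondecreasing_cvgn_le (@ell2_cvg _ y) n.
  by apply: nondecreasing_series => k _ _; exact: sqr_ge0.
pose g := h / (2 * L.+1%:R); have g0 : 0 < g by rewrite divr_gt0 // mulr_gt0.
have ratP (a : R) : exists q : rat, (a - ratr q) ^+ 2 <= g.
  have : a < a + Num.sqrt g by rewrite ltrDl sqrtr_gt0.
  move=> /rat_in_itvoo[q]; rewrite in_itv /= => /andP[q1 q2]; exists q.
  rewrite -[leRHS](sqr_sqrtr (ltW g0)) -sqrrN opprB.
  by rewrite ler_pXn2r ?nnegrE ?sqrtr_ge0 //; lra.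
have /choice[q qP] : forall k, exists q : rat * rat,
    Normc.normc (y k - (ratr q.1 +i* ratr q.2)%C) ^+ 2 <= 2 * g.
  move=> k; case: (y k) => a b.
  have [q1 h1] := ratP a; have [q2 h2] := ratP b.
  exists (q1, q2); rewrite /= sqr_sqrtr ?addr_ge0 ?sqr_ge0 //.
  by move: h1 h2; lra.
exists (mkseq q L); set z := y - _.
have z1 k : (k < L)%N -> Normc.normc (z k) ^+ 2 <= 2 * g.
  by move=> kL; rewrite /z ell2B /= /rational_seq nth_mkseq.
have z2 k : (L <= k)%N -> z k = y k.
  by move=> Lk; rewrite /z ell2B /= rational_seq_default ?size_mkseq // subr0.
clearbody z; suff : ell2_norm z <= e / 2 by move=> /le_lt_trans; apply; lra.
apply: ell2_norm_le => [|n]; first by rewrite divr_ge0 // ltW.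
have eE : (e / 2) ^+ 2 = h + h by rewrite /h; field.
have zL : \sum_(0 <= k < L) Normc.normc (z k) ^+ 2 <= h.
  apply: (@le_trans _ _ (\sum_(0 <= k < L) 2 * g)).
    by rewrite big_nat [leRHS]big_nat; apply: ler_sum => k /andP[_]; exact: z1.
  rewrite sumr_const_nat subn0 -[_ *+ L]mulr_natr.
  rewrite (_ : 2 * g = h / L.+1%:R); last first.
    have : L.+1%:R != 0 :> R by rewrite pnatr_eq0.
    by rewrite /g; move: (L.+1%:R : R) => r r0; field.
  by rewrite mulrAC ler_pdivrMr ?ltr0n // ler_pM2l // ler_nat.
rewrite /series /= eE; have [nL|Ln] := leqP n L.
  apply: le_trans (_ : h <= _); last by rewrite lerDl ltW.
  apply: le_trans zL; rewrite [leRHS](@big_cat_nat _ _ _ n) //= lerDl.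
  by apply: sumr_ge0 => k _; exact: sqr_ge0.
rewrite (@big_cat_nat _ _ _ L) ?(ltnW Ln) //=; apply: lerD => //.
have := SL n; rewrite /S (@big_cat_nat _ _ _ L) ?(ltnW Ln) //= lerD2l.
apply: le_trans; rewrite big_nat [leRHS]big_nat le_eqVlt; apply/orP; left.
by apply/eqP/eq_bigr => k /andP[/z2 -> _].
Qed.

Lemma injective_unbounded (g : nat -> nat) (K : nat) :
  injective g -> exists p, (K <= g p)%N.
Proof.
move=> gi; have [/hasP[p _ Kp]|] := boolP (has (fun p => K <= g p)%N (iota 0 K.+1)).
  by exists p.
move=> /hasPn nK; suff : (size (map g (iota 0 K.+1)) <= size (iota 0 K))%N.
  by rewrite size_map !size_iota ltnn.
apply: uniq_leq_size; first by rewrite map_inj_uniq ?iota_uniq.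
by move=> _ /mapP[p /nK pK ->]; rewrite mem_iota leq0n add0n ltnNge.
Qed.

(** An enumeration of the pairs (natural number, finite rational sequence)
meets each sequence infinitely often. It may thus be censored, the [k]-th value
being replaced by 0 when too large for its index [k], without losing density. *)
Lemma small_patterns_dense (R : realType) : exists d : nat -> ell2 R,
  [/\ forall k j, (k <= j)%N -> d k j = 0,
      forall k j, Normc.normc (d k j) * 2 ^+ j <= 2 ^+ k
    & forall y e K, 0 < e -> exists2 k, (K <= k)%N & ell2_norm (d k - y) < e].
Proof.
pose decode k : ell2 R :=
  if unpickle k is Some ps then rational_vector R (ps : nat * seq (rat * rat)).2
  else 0.
pose small (z : ell2 R) k := (forall j, (k <= j)%N -> z j = 0) /\
  (forall j, Normc.normc (z j) * 2 ^+ j <= 2 ^+ k).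
pose d k := if `[< small (decode k) k >] then decode k else 0.
have d_small k : small (d k) k.
  rewrite /d; case: asboolP => // _; split=> j //.
  by rewrite Normc.normc0 mul0r exprn_ge0.
exists d; split=> [k|k|y e K e0]; [exact: (d_small k).1|exact: (d_small k).2|].
have [s sy] := rational_vector_dense y e0; set z := rational_vector R s in sy.
have [K' zK'] : exists K', forall k, (K' <= k)%N -> small z k.
  pose B := \sum_(0 <= j < size s) Normc.normc (z j) * 2 ^+ j.
  have t0 j : 0 <= Normc.normc (z j) * 2 ^+ j by rewrite mulr_ge0 ?normc_ge0.
  exists (maxn (size s) (Num.trunc B).+1) => k; rewrite geq_max => /andP[sk Bk].
  split=> j; first by move=> /(leq_trans sk); exact: rational_seq_default.
  have [sj|js] := leqP (size s) j.
    by rewrite (rational_seq_default R sj : z j = 0) Normc.normc0 mul0r exprn_ge0.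
  apply: (@le_trans _ _ B).
    by rewrite /B (bigD1_seq j) ?mem_index_iota ?iota_uniq //= lerDl sumr_ge0.
  apply: le_trans (ltW (truncnS_gt B)) _; rewrite -natrX ler_nat.
  by apply: leq_trans Bk (ltnW (ltn_expl k _)).
(* The first component of the code is free: it pushes the index past any bound. *)
have [p pK] : exists p : nat, (maxn K K' <= pickle (p, s))%N.
  apply: (@injective_unbounded (fun p : nat => pickle (p, s))).
  by move=> p p' /(pcan_inj pickleK)[].
move: pK; rewrite geq_max => /andP[pK pK']; exists (pickle (p, s)) => //.
rewrite /d /decode pickleK /= -/z asboolT; last exact: zK'.
by rewrite -[z - y]opprB -scaleN1r ell2_normZ normcN Normc.normc1 mul1r.
Qed.

(** * A hypercyclic vector supported on sparse windows *)

Lemma geometric_tail_norm (R : realType) (u : ell2 R) (L : nat) (c : R) :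
  0 <= c -> 4 / 2 ^+ L <= c ^+ 2 ->
  (forall j, (j < L)%N -> u j = 0) ->
  (forall j, (L <= j)%N -> Normc.normc (u j) ^+ 2 <= 2 / 2 ^+ j) ->
  ell2_norm u <= c.
Proof.
move=> c0 cL u0 uL; apply: ell2_norm_le => // n.
have z n' : (n' <= L)%N -> series (fun k => Normc.normc (u k) ^+ 2) n' = 0.
  move=> nL; rewrite /series /= big_nat big1 // => k /andP[_ kn].
  by rewrite u0 ?Normc.normc0 ?expr0n //; exact: leq_trans kn nL.
have [nL|/ltnW Ln] := leqP n L; first by rewrite z // sqr_ge0.
apply: le_trans cL; rewrite -(subnKC Ln).
(* [4 / 2 ^ L - 4 / 2 ^ n] is the sum of [2 / 2 ^ j] over [L <= j < n]. *)
suff : series (fun k => Normc.normc (u k) ^+ 2) (L + (n - L))%N <=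
    4 / 2 ^+ L - 4 / 2 ^+ (L + (n - L)).
  by move=> /le_trans; apply; rewrite gerBl divr_ge0 ?exprn_ge0.
elim: (n - L)%N => [|k ih]; first by rewrite addn0 subrr z.
rewrite addnS /series /= big_nat_recr //=.
apply: le_trans (lerD ih (uL _ (leq_addr _ _))) _.
rewrite le_eqVlt; apply/orP; left; apply/eqP; rewrite exprS.
by field; rewrite !expf_neq0.
Qed.

Lemma iter_double_shift (R : realType) (n : nat) (x : ell2 R) (j : nat) :
  iter n (fun y : ell2 R => 2 *: backward_shift y) x j = 2 ^+ n * x (n + j)%N.
Proof.
elim: n j => [|n ih] j; first by rewrite expr0 mul1r.
by rewrite iterS ell2Z /= ih exprS mulrA addnS.
Qed.

Lemma normc_exp2 (R : realType) (n : nat) : Normc.normc (2 ^+ n : R[i]) = 2 ^+ n.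
Proof.
elim: n => [|n ih]; first by rewrite !expr0 Normc.normc1.
rewrite !exprS Normc.normcM ih; congr (_ * _).
by rewrite -[2]/(1 *+ 2) normcMn Normc.normc1.
Qed.

(** The pattern [d m] is placed at position [m ^ 3], scaled so that [m ^ 3]
steps of the doubled shift bring it back to [d m]. *)
Definition scattered_seq (R : realType) (d : nat -> ell2 R) (n : nat) : R[i] :=
  d (cbrt n) (n - cbrt n ^ 3)%N / 2 ^+ (cbrt n ^ 3).

(** At position [n = m ^ 3 + j] of block [m], this is the size condition on
[d m j] multiplied by [2 ^ (m ^ 3)] and divided by the same power. *)
Lemma scattered_seq_bound (R : realType) (d : nat -> ell2 R) (n : nat) :
  (forall k j, Normc.normc (d k j) * 2 ^+ j <= 2 ^+ k) ->
  Normc.normc (scattered_seq d n) * 2 ^+ n <= 2 ^+ cbrt n.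
Proof.
move=> dP; have /andP[h _] := cbrt_bounds n; apply: le_trans (dP _ (n - cbrt n ^ 3)%N).
rewrite /scattered_seq Normc.normcM Normc.normcV normc_exp2.
have -> : (2 : R) ^+ n = 2 ^+ (cbrt n ^ 3) * 2 ^+ (n - cbrt n ^ 3).
  by rewrite -exprD subnKC.
rewrite le_eqVlt; apply/orP; left; apply/eqP; field.
by rewrite expf_neq0.
Qed.

Lemma sqr_le_half_exp (R : realType) (t : R) (M j : nat) :
  0 <= t -> t * 2 ^+ j <= 2 ^+ M -> (2 * M <= j.+1)%N -> t ^+ 2 <= 2 / 2 ^+ j.
Proof.
move=> t0 tM Mj; rewrite ler_pdivlMr ?exprn_gt0 // -(@ler_pM2r _ (2 ^+ j)) ?exprn_gt0 //.
rewrite -mulrA -expr2 -exprMn -exprS.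
apply: (@le_trans _ _ ((2 ^+ M) ^+ 2)).
  by rewrite ler_pXn2r // nnegrE ?mulr_ge0 ?exprn_ge0.
by rewrite -exprM ler_eXn2l ?ltr1n // mulnC.
Qed.

Lemma scattered_seq_summable (R : realType) (d : nat -> ell2 R) :
  (forall k j, Normc.normc (d k j) * 2 ^+ j <= 2 ^+ k) ->
  scattered_seq d \in @square_summable R.
Proof.
move=> dP; apply/square_summableP.
have gc : cvgn (series (geometric (2 : R) 2^-1)).
  by apply: is_cvg_geometric_series; rewrite ger0_norm // invf_lt1 // ltr1n.
apply: series_le_cvg gc => n /=; first exact: sqr_ge0.
  by rewrite mulr_ge0 // exprn_ge0 // invr_ge0.
rewrite exprVn; apply: (@sqr_le_half_exp _ _ (cbrt n)).
- exact: normc_ge0.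
- exact: scattered_seq_bound.
have /andP[+ _] := cbrt_bounds n.
by case: (cbrt n) => [|[|m]]; rewrite ?expnS ?expn0; nia.
Qed.

(** The vector [T^(m^3) x] agrees with [d m] on the first
[(m + 1) ^ 3 - m ^ 3] coordinates. At a later coordinate [j], falling in a block
[M > m], its modulus is at most [2 ^ (M - j)], where [2 M <= j + 1] because blocks
are so long; so the remainder is dominated by a geometric tail. *)
Lemma scattered_hypercyclic (R : realType) (d : nat -> ell2 R)
    (d0 : forall k j, (k <= j)%N -> d k j = 0)
    (dP : forall k j, Normc.normc (d k j) * 2 ^+ j <= 2 ^+ k)
    (d_dense : forall y e K, 0 < e ->
      exists2 k, (K <= k)%N & ell2_norm (d k - y) < e) :
  hypercyclic_vectors (fun y : ell2 R => 2 *: backward_shift y)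
    (Ell2 (scattered_seq_summable dP)).
Proof.
set x := Ell2 _; set T := fun _ => _ => O [y Oy] oO.
have /nbhs_ballP[[e e'] /= e0 yO] := open_nbhs_nbhs (conj oO Oy).
move: e0; rewrite ltcE /= => /andP[/eqP e'0 e0]; rewrite {e'}e'0 in yO.
have [K eK] : exists K : nat, 4 / (e / 2) ^+ 2 < K%:R.
  by eexists; exact: truncnS_gt.
have e2 : 0 < e / 2 by rewrite divr_gt0.
have [m Km dy] := d_dense y _ K e2.
exists (iter (m ^ 3) T x); split; last by exists (m ^ 3)%N.
apply: yO; rewrite -ball_normE /= ell2_normE ltcR.
pose u := iter (m ^ 3) T x - d m.
have -> : y - iter (m ^ 3) T x = -1 *: (u + (d m - y)).
  by rewrite /u scaleN1r addrA subrK opprB.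
rewrite ell2_normZ normcN Normc.normc1 mul1r.
apply: le_lt_trans (ell2_normD _ _) _; rewrite [ltRHS]splitr.
apply: ler_ltD dy.
have uE j : u j = 2 ^+ (m ^ 3) * scattered_seq d (m ^ 3 + j)%N - d m j.
  by rewrite /u ell2B iter_double_shift.
have lm : (m <= m.+1 ^ 3 - m ^ 3)%N by rewrite !expnS expn0; nia.
apply: (@geometric_tail_norm _ _ (m.+1 ^ 3 - m ^ 3)) => [|||j lj].
- exact: ltW.
- rewrite ler_pdivrMr ?exprn_gt0 // mulrC -ler_pdivrMr ?exprn_gt0 //.
  apply: le_trans (ltW eK) _; rewrite -natrX ler_nat.
  by apply: leq_trans (leq_trans Km lm) (ltnW (ltn_expl _ _)).
- move=> j; rewrite ltn_subRL => jl; rewrite uE /scattered_seq.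
  have -> : cbrt (m ^ 3 + j) = m by apply: cbrt_eq; rewrite leq_addr.
  by rewrite addKn mulrC divfK ?expf_neq0 // subrr.
rewrite uE d0 ?subr0; last exact: leq_trans lm lj.
have mM : (m < cbrt (m ^ 3 + j))%N.
  by apply: cbrt_ge; rewrite -leq_subLR.
have /andP[Mj _] := cbrt_bounds (m ^ 3 + j).
apply: (@sqr_le_half_exp _ _ (cbrt (m ^ 3 + j))); first exact: normc_ge0.
  rewrite Normc.normcM normc_exp2 mulrAC -exprD mulrC.
  exact: scattered_seq_bound.
move: mM Mj; case: (cbrt _) => // M; rewrite ltnS => mM; rewrite !expnS expn0.
nia.
Qed.

(** * The rotated orbit *)

Lemma exists_phase (R : realType) (z : R[i]) :
  exists2 t : R, 0 <= t < 1 & complex.Re (expi (2 * pi * t) * z) <= 0.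
Proof.
case: z => a b; have [a0|a0] := leP a 0.
  by exists 0; rewrite ?lexx ?ltr01 // /expi mulr0 cos0 sin0 /=; lra.
exists (1 / 2); first by apply/andP; split; lra.
rewrite (_ : 2 * pi * _ = pi); last by field.
by rewrite /expi cospi sinpi /=; lra.
Qed.

Theorem proposition5p3 (R : realType) :
  let T : ell2 R -> ell2 R := fun y => 2 *: backward_shift y in
  exists (f : nat -> R) (x : ell2 R),
    [/\ uniformly_distributed f,
        hypercyclic_vectors T x
      & ~ dense [set expi (2 * pi * f n) *: iter n T x
                | n in [set n | (1 <= n)%N]]].
Proof.
move=> T; have [d [d0 dP d_dense]] := small_patterns_dense R.
pose x := Ell2 (scattered_seq_summable dP).
have /choice[phase phaseP] : forall n, exists t : R,
    0 <= t < 1 /\ complex.Re (expi (2 * pi * t) * x n) <= 0.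
  by move=> n; have [t ? ?] := exists_phase (x n); exists t.
pose f n : R := let m := cbrt n in let j := (n - m ^ 3)%N in
  if (j < m)%N then phase n else j%:R / (m.+1 ^ 3 - m ^ 3)%:R.
have f_block : cubic_block_sequence f.
  move=> m j mj; rewrite /f.
  have -> : cbrt (m ^ 3 + j) = m by apply: cbrt_eq; rewrite leq_addr.
  rewrite addKn; have [jm|jm] := ltnP j m.
    by split; [exact: (phaseP _).1|].
  split=> //; rewrite -ltn_subRL in mj.
  have l0 : (0 : R) < (m.+1 ^ 3 - m ^ 3)%:R by rewrite ltr0n; exact: leq_ltn_trans mj.
  by rewrite divr_ge0 //= ltr_pdivrMr // mul1r ltr_nat.
exists f, x; split.
- exact: cubic_block_sequence_uniformly_distributed.
- exact: (scattered_hypercyclic d0 dP d_dense).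
have coord0 n : complex.Re (expi (2 * pi * f n) * x n) <= 0.
  rewrite /f; case: ltnP => [_|j_large]; first exact: (phaseP n).2.
  by rewrite /x /= /scattered_seq d0 // mul0r mulr0.
(* The ball around [e_0] lies in the half-space where the real part of the
   coordinate of index 0 is positive. *)
move=> /(_ (ball (ell2_basis R 0) 1)) [].
- by exists (ell2_basis R 0); exact: ballxx.
- exact: ball_open.
move=> w [+ [n _ wE]]; rewrite -{w}wE -ball_normE /= ell2_normE.
set v := _ - _ => v1; have {}v1 : ell2_norm v < 1 by rewrite -ltcR.
have : Normc.normc (v 0%N) < 1 := le_lt_trans (normc_le_ell2_norm v 0) v1.
have -> : v 0%N = 1 - 2 ^+ n * (expi (2 * pi * f n) * x n).
  by rewrite /v ell2B ell2Z iter_double_shift addn0 mulrCA.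
have : complex.Re (2 ^+ n * (expi (2 * pi * f n) * x n)) <= 0.
  have := coord0 n; case: (_ * x n) => a b /= a0.
  rewrite (_ : 2 ^+ n = (2 ^+ n)%:C%C :> R[i]); last by rewrite rmorphXn /= rmorph_nat.
  by rewrite /= mul0r subr0 pmulr_rle0 // exprn_gt0.
case: (2 ^+ n * _) => a b /= a0; apply/negP; rewrite -leNgt.
rewrite -[leLHS]sqrtr1 ler_wsqrtr //.
have := sqr_ge0 (0 - b); have := sqr_ge0 a.
by rewrite (_ : (1 - a) ^+ 2 = 1 - 2 * a + a ^+ 2); [lra | ring].
Qed.
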